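(* Let $f_0\in\mathbb{C}[x_1,\dots,x_n]$ be an $\mathfrak{S}_n$-harmonic polynomial. Then there exists a polynomial $f_1\in\mathbb{C}[x_1,\dots,x_n]$ such that $$\nabla_k f_1=-\widetilde{D}_k f_0\qquad\text{for } k=1,2.$$
   Context: Let $\partial_i=\partial/\partial x_i$. For $k\ge 1$ put $\nabla_k=\sum_{i=1}^n\partial_i^k$ and $\widetilde{D}_k=\sum_{i=1}^n x_i\partial_i^{k+1}$. A polynomial $f\in\mathbb{C}[x_1,\dots,x_n]$ is $\mathfrak{S}_n$-harmonic if $\nabla_k f=0$ for all $k\ge 1$. *)

(* Defs.v *)
From mathcomp Require Import all_boot all_order all_algebra.
From mathcomp Require Import reals complex.
From mathcomp Require Import mpoly.

Set Implicit Arguments.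
Unset Strict Implicit.
Unset Printing Implicit Defensive.

Import GRing.Theory.
Local Open Scope ring_scope.

(* For R : realType, the field of complex numbers is R[i]. Variables are indexed
   from 0, and p^`M(i, k) is the k-fold partial derivative of p in 'X_i. *)
Definition nabla (R : realType) (n k : nat) (f : {mpoly R[i][n]}) :
    {mpoly R[i][n]} :=
  \sum_(i < n) f^`M(i, k).

Definition Dtilde (R : realType) (n k : nat) (f : {mpoly R[i][n]}) :
    {mpoly R[i][n]} :=
  \sum_(i < n) 'X_i * f^`M(i, k.+1).

Definition harmonic (R : realType) (n : nat) (f : {mpoly R[i][n]}) : Prop :=
  forall k : nat, (1 <= k)%N -> nabla k f = 0.

(* Main.v *)
From HB Require Import structures.
Require Import Defs.
From mathcomp Require Import all_boot all_order all_algebra.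
From mathcomp Require Import reals complex.
From mathcomp Require Import mpoly.
From mathcomp Require Import ring.

Set Implicit Arguments.
Unset Strict Implicit.
Unset Printing Implicit Defensive.

Import GRing.Theory Num.Theory.
Local Open Scope ring_scope.

(** The two equations [nabla 1 f1 = g1] and [nabla 2 f1 = g2] have constant
coefficients, so a necessary condition is [nabla 2 g1 = nabla 1 g2].  In at
least two variables the power sums p_1 and p_2 are coprime, and this condition
is also sufficient ([dpsum12_solve]).  For [g_k = - Dtilde k f0] with [f0]
harmonic it holds because the commutator of [nabla l] and [Dtilde k] is
[l * nabla (k + l)] ([dpsum_mulX_sum]): both sides vanish.

Sufficiency is proved by elimination.  Let d_i be the derivation in x_i, fix a
variable x_a, and let S be the sum of the d_j for j != a.  Modulo
[nabla 1 = d_a + S], the derivation d_a may be replaced by - S, which turns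
[nabla 2] into an operator Q ([dquad a]) that does not involve d_a.  If I_a is
the primitive with respect to x_a, then [nabla 1 = d_a (1 + I_a S)].  The
operator I_a preserves the degree in the variables other than x_a and S lowers
it, so I_a S is locally nilpotent and [1 + I_a S] is invertible; moreover it
commutes with Q.  This change of unknown makes the first equation
[d_a w = g1], whose solutions are I_a g1 plus a polynomial free of x_a.  What
remains is to solve [Q w = c] among polynomials free of x_a ([dquad_surj]).
In a second variable x_b, Q has the form [2 d_b^2 + A d_b + B] with A and B in
the derivations other than d_a and d_b, hence [Q I_b^2 = 2 (1 + N)] with N
locally nilpotent, for the degree in the variables other than x_b. *)

(** * Unipotent operators on a filtered group *)

(** Instead of summing the geometric series of - N, the solution is peeled off
one filtration step at a time: if u solves the equation for N v, then v - u
solves it for v. *)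
Lemma unipotent_surj (V : zmodType) (N : {additive V -> V})
    (W : nat -> V -> Prop) :
    (forall v, W 0 v -> v = 0) -> (forall d, W d 0) ->
    (forall d u v, W d u -> W d v -> W d (u - v)) ->
    (forall d v, W d v -> W d.+1 v) ->
    (forall d v, W d.+1 v -> W d (N v)) ->
  forall d v, W d v -> exists2 u, W d u & u + N u = v.
Proof.
move=> W0 Wz WB WS WN; elim=> [|d IH] v Wv.
  by exists 0 => //; rewrite raddf0 addr0 (W0 _ Wv).
have [u Wu eq_u] := IH _ (WN _ _ Wv).
exists (v - u); first by apply: WB => //; apply: WS.
by rewrite raddfB -eq_u addrK subrK.
Qed.

Lemma unipotent_inj (V : zmodType) (N : {additive V -> V})
    (W : nat -> V -> Prop) :
    (forall v, W 0 v -> v = 0) ->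
    (forall d v, W d.+1 v -> W d (N v)) ->
  forall d v, W d v -> v + N v = 0 -> v = 0.
Proof.
move=> W0 WN; elim=> [|d IH] v Wv eq_v; first exact: W0.
suff Nv0: N v = 0 by rewrite -eq_v Nv0 addr0.
by apply: IH; [apply: WN | rewrite -raddfD eq_v raddf0].
Qed.

(** * Power sums of derivations *)

Section PartialPowerSums.

Variables (F : numFieldType) (n : nat).
Implicit Types (f g : {mpoly F[n]}) (i j : 'I_n) (m : 'X_{1..n}).
Implicit Types (P : pred 'I_n).

(** For the full predicate this is convertible to [nabla k]; the others isolate
the variables that play a special role in the elimination. *)
Definition dpsum P k f : {mpoly F[n]} := \sum_(j | P j) f^`M(j, k).

Lemma dpsum_is_linear P k : linear (dpsum P k).
Proof.
move=> c f g; rewrite /dpsum scaler_sumr -big_split /=.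
by apply: eq_bigr => j _; rewrite linearP.
Qed.

HB.instance Definition _ P k :=
  GRing.isLinear.Build F {mpoly F[n]} {mpoly F[n]} _ (dpsum P k)
    (dpsum_is_linear P k).

Lemma dpsum_comm (L : {additive {mpoly F[n]} -> {mpoly F[n]}}) P k :
    (forall j, P j -> forall f, L f^`M(j) = (L f)^`M(j)) ->
  forall f, L (dpsum P k f) = dpsum P k (L f).
Proof.
move=> LP f; rewrite /dpsum raddf_sum; apply: eq_bigr => j Pj.
by elim: k => [|k IH]; rewrite ?mderivn0 // !mderivnS LP // IH.
Qed.

Lemma mderiv_dpsum i P k f : (dpsum P k f)^`M(i) = dpsum P k f^`M(i).
Proof. by apply: dpsum_comm => j _ g; apply: mderiv_comm. Qed.

Lemma dpsumC P k P' k' f :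
  dpsum P k (dpsum P' k' f) = dpsum P' k' (dpsum P k f).
Proof. by apply: dpsum_comm => j _ g; rewrite mderiv_dpsum. Qed.

Lemma dpsumD1_1 i P f : P i ->
  dpsum P 1 f = f^`M(i) + dpsum [pred j | P j && (j != i)] 1 f.
Proof. by move=> Pi; rewrite /dpsum (bigD1 i) //= nderivn1. Qed.

Lemma dpsumD1_2 i P f : P i ->
  dpsum P 2 f = f^`M(i)^`M(i) + dpsum [pred j | P j && (j != i)] 2 f.
Proof. by move=> Pi; rewrite /dpsum (bigD1 i) //= mderivnS nderivn1. Qed.

(** The Leibniz formula, in which only the first derivative of the factor
survives. *)
Lemma mderivn_mulX i k f :
  ('X_i * f)^`M(i, k.+1) = 'X_i * f^`M(i, k.+1) + f^`M(i, k) *+ k.+1.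
Proof.
have dX: ('X_i : {mpoly F[n]})^`M(i) = 1.
  by rewrite mderivX mnm1E eqxx scale1r -{1}[U_(i)%MM]add0m addmK mpolyX0.
elim: k => [|k IH]; first by rewrite !nderivn1 mderivn0 mderivM dX mul1r addrC.
by rewrite mderivnS IH raddfD raddfMn /= mderivM dX mul1r -!mderivnS addrAC
  -mulrS addrC.
Qed.

Lemma mderivn_mulX_neq i j k f : j != i ->
  ('X_i * f)^`M(j, k) = 'X_i * f^`M(j, k).
Proof.
move=> ji; have dX: ('X_i : {mpoly F[n]})^`M(j) = 0.
  by rewrite mderivX mnm1E eq_sym (negPf ji) scale0r.
by elim: k => [|k IH]; rewrite ?mderivn0 // !mderivnS IH mderivM dX mul0r add0r.
Qed.

Lemma dpsum_mulX i k f :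
  dpsum predT k.+1 ('X_i * f)
    = 'X_i * dpsum predT k.+1 f + f^`M(i, k) *+ k.+1.
Proof.
rewrite /dpsum mulr_sumr (bigD1 i) //= [in RHS](bigD1 i) //=.
rewrite mderivn_mulX addrAC; congr (_ + _ + _).
by apply: eq_bigr => j ji; rewrite mderivn_mulX_neq.
Qed.

(** * Primitives in one variable *)

Definition mprim i f : {mpoly F[n]} :=
  \sum_(m <- msupp f) (f@_m / (m i).+1%:R) *: 'X_[m + U_(i)].

(** This covers [m i = 0], where the truncated subtraction is harmless because
the field inverse of 0 is 0. *)
Lemma mcoeff_mprim i f m : (mprim i f)@_m = f@_(m - U_(i)) / (m i)%:R.
Proof.
rewrite /mprim raddf_sum /=.
under eq_bigr do rewrite mcoeffZ mcoeffX.
have [mi0|mi_gt0] := posnP (m i).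
  rewrite mi0 invr0 mulr0 big1 // => m' _; case: eqP => [e|_]; last exact: mulr0.
  by move: mi0; rewrite -e mnmDE mnm1E eqxx addn1.
have em: m = (m - U_(i) + U_(i))%MM.
  by rewrite submK //; apply/mnm_lepP => j; rewrite mnm1E; case: eqP => // <-.
have emi: ((m - U_(i))%MM i).+1 = m i by rewrite {2}em mnmDE mnm1E eqxx addn1.
have [mf|mf] := boolP ((m - U_(i))%MM \in msupp f).
  rewrite (bigD1_seq (m - U_(i))%MM) //= -em eqxx mulr1 emi big1 ?addr0 //.
  move=> m' ne; case: eqP => [e|_]; last exact: mulr0.
  by rewrite -e addmK eqxx in ne.
rewrite (memN_msupp_eq0 mf) mul0r big1_seq // => m' /= m'f.
case: eqP => [e|_]; last exact: mulr0.
by rewrite -e addmK m'f in mf.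
Qed.

Lemma mprim_is_linear i : linear (mprim i).
Proof.
move=> c f g; apply/mpolyP => m; rewrite mcoeffD mcoeffZ !mcoeff_mprim.
by rewrite mcoeffD mcoeffZ mulrDl mulrA.
Qed.

HB.instance Definition _ i :=
  GRing.isLinear.Build F {mpoly F[n]} {mpoly F[n]} _ (mprim i)
    (mprim_is_linear i).

Lemma mprimK i f : (mprim i f)^`M(i) = f.
Proof.
apply/mpolyP => m; rewrite mcoeff_deriv mcoeff_mprim addmK.
by rewrite mnmDE mnm1E eqxx addn1 -[LHS]mulr_natr mulfVK // pnatr_eq0.
Qed.

Lemma mderiv_mprim i j f : j != i -> (mprim i f)^`M(j) = mprim i f^`M(j).
Proof.
move=> ji; apply/mpolyP => m; rewrite mcoeff_deriv !mcoeff_mprim mcoeff_deriv.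
rewrite mnmDE mnmBE !mnm1E (negPf ji) eq_sym (negPf ji) addn0 subn0.
have [->|mi_gt0] := posnP (m i); first by rewrite invr0 !mulr0 mul0rn.
rewrite mulrnAl; congr (_ *+ _); congr (f@_ _ / _).
apply/mnmP => l; rewrite !(mnmDE, mnmBE, mnm1E); case: (eqVneq i l) => [<-|_].
  by rewrite (negPf ji) !addn0.
by rewrite !subn0.
Qed.

Lemma mprim_dpsum i P k f : (forall j, P j -> j != i) ->
  mprim i (dpsum P k f) = dpsum P k (mprim i f).
Proof.
by move=> Pi; apply: dpsum_comm => j /Pi ji g; rewrite /= mderiv_mprim.
Qed.

(** * Degree in the variables other than a given one *)

(** The degree of f in the variables other than x_i is less than d. *)
Definition codeg_lt i d f : Prop :=
  forall m, (d + m i <= mdeg m)%N -> f@_m = 0.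

Lemma codeg_lt0 i f : codeg_lt i 0 f -> f = 0.
Proof.
move=> Wf; apply/mpolyP => m; rewrite mcoeff0 Wf // add0n mdegE (bigD1 i) //=.
exact: leq_addr.
Qed.

Lemma codeg_lt_msize i f : codeg_lt i (msize f) f.
Proof.
move=> m le_m; apply/memN_msupp_eq0/msize_mdeg_ge.
exact: leq_trans (leq_addr _ _) le_m.
Qed.

Lemma codeg_lt_zero i d : codeg_lt i d 0.
Proof. by move=> m _; rewrite mcoeff0. Qed.

Lemma codeg_ltD i d f g :
  codeg_lt i d f -> codeg_lt i d g -> codeg_lt i d (f + g).
Proof. by move=> Wf Wg m le_m; rewrite mcoeffD Wf // Wg // addr0. Qed.

Lemma codeg_ltZ i d c f : codeg_lt i d f -> codeg_lt i d (c *: f).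
Proof. by move=> Wf m le_m; rewrite mcoeffZ Wf // mulr0. Qed.

Lemma codeg_ltB i d f g :
  codeg_lt i d f -> codeg_lt i d g -> codeg_lt i d (f - g).
Proof. by move=> Wf Wg; rewrite -scaleN1r; apply/codeg_ltD/codeg_ltZ. Qed.

Lemma codeg_ltS i d f : codeg_lt i d f -> codeg_lt i d.+1 f.
Proof. by move=> Wf m le_m; apply/Wf/ltnW; rewrite addSn in le_m. Qed.

Lemma codeg_lt_mprim i d f : codeg_lt i d f -> codeg_lt i d (mprim i f).
Proof.
move=> Wf m le_m; rewrite mcoeff_mprim.
have [->|mi_gt0] := posnP (m i); first by rewrite invr0 mulr0.
have em: m = (m - U_(i) + U_(i))%MM.
  by rewrite submK //; apply/mnm_lepP => j; rewrite mnm1E; case: eqP => // <-.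
rewrite Wf ?mul0r //; move: le_m.
by rewrite {1 2}em mnmDE mdegD mdeg1 mnm1E eqxx addnA leq_add2r.
Qed.

Lemma codeg_lt_mderiv i j d f : j != i ->
  codeg_lt i d.+1 f -> codeg_lt i d f^`M(j).
Proof.
move=> ji Wf m le_m; rewrite mcoeff_deriv Wf ?mul0rn // mnmDE mdegD mdeg1.
by rewrite mnm1E (negPf ji) addn0 addSn addn1 ltnS.
Qed.

Lemma codeg_lt_dpsum i P k d f : (forall j, P j -> j != i) ->
  codeg_lt i d.+1 f -> codeg_lt i d (dpsum P k.+1 f).
Proof.
move=> Pi Wf; rewrite /dpsum; elim/big_ind: _ => [|g h|j /Pi ji].
- exact: codeg_lt_zero.
- exact: codeg_ltD.
elim: k => [|k IH]; first by rewrite nderivn1; apply: codeg_lt_mderiv.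
by rewrite mderivnS; apply/codeg_lt_mderiv/codeg_ltS.
Qed.

(** * Solving the system given by the first two power sums *)

(** The image of p_2 under x_i |-> - (sum of the other variables), evaluated at
the derivations. *)
Definition dquad i f := dpsum (predC1 i) 1 (dpsum (predC1 i) 1 f)
  + dpsum (predC1 i) 2 f.

(** With s the sum of the other variables, this is p_2 = q + (x_i - s) p_1, a
consequence of x_i^2 - s^2 = (x_i - s) (x_i + s). *)
Lemma dpsum2_dquad i f :
  dpsum predT 2 f = dquad i f
    + (dpsum predT 1 f)^`M(i) - dpsum (predC1 i) 1 (dpsum predT 1 f).
Proof.
rewrite /dquad !(@dpsumD1_1 i predT) // (@dpsumD1_2 i predT) //=.
rewrite !raddfD /= mderiv_dpsum.
set s := dpsum _ 1 (f^`M(i)); set t := f^`M(i)^`M(i).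
set u := dpsum _ 1 (dpsum _ _ _); set v := dpsum _ 2 f.
ring.
Qed.

(** With S and T the first and second power sums of the derivations other than
d_a and d_b, [dquad a = (d_b + S)^2 + d_b^2 + T].  Applied to I_b^2 g, where I_b
is the primitive in x_b, this is [2 (g + N g)] with
[N = S I_b + (S^2 + T) I_b^2 / 2], and N lowers the degree in the variables
other than x_b.  All these operators preserve the polynomials free of x_a, so
this condition is put into the filtration. *)
Lemma dquad_surj (a b : 'I_n) c : b != a -> c^`M(a) = 0 ->
  exists2 v : {mpoly F[n]}, v^`M(a) = 0 & dquad a v = c.
Proof.
move=> ba ca.
pose P := [pred j | (j != a) && (j != b)].
have Pb j : P j -> j != b by case/andP.
pose S := dpsum P 1; pose T := dpsum P 2; pose I := mprim b.
pose N : {additive {mpoly F[n]} -> {mpoly F[n]}} :=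
  (S \o I) \+ (2^-1 \*: ((S \o S \o I \o I) \+ (T \o I \o I))).
have NE f : N f = S (I f) + 2^-1 *: (S (S (I (I f))) + T (I (I f))) by [].
pose W d f := codeg_lt b d f /\ f^`M(a) = 0.
have aI f : (I f)^`M(a) = I f^`M(a) by rewrite mderiv_mprim // eq_sym.
have WS d f : W d f -> W d.+1 f by case=> Wf af; split=> //; apply: codeg_ltS.
have WI d f : W d f -> W d (I f).
  by case=> Wf af; split; [apply: codeg_lt_mprim | rewrite aI af /I raddf0].
have Wsum k d f : W d.+1 f -> W d (dpsum P k.+1 f).
  by case=> Wf af; split; [apply: codeg_lt_dpsum | rewrite mderiv_dpsum af raddf0].
have WD d f g : W d f -> W d g -> W d (f + g).
  move=> [Wf af] [Wg ag]; split; first exact: codeg_ltD.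
  by rewrite raddfD /= af ag addr0.
have WZ d k f : W d f -> W d (k *: f).
  move=> [Wf af]; split; first exact: codeg_ltZ.
  by rewrite linearZ /= af scaler0.
have [g [_ ag] Ng]: exists2 g, W (msize c) g & g + N g = c.
  apply: (unipotent_surj _ _ _ WS) => [f [/codeg_lt0]|d|d f g Wf Wg|d f Wf|] //.
  - by split; [apply: codeg_lt_zero | rewrite raddf0].
  - by apply: WD => //; rewrite -scaleN1r; apply: WZ.
  - rewrite NE; apply/WD; first by apply/Wsum/WI.
    apply/WZ/WD; last by apply/Wsum/WI/WI.
    by apply/Wsum/WS/Wsum/WI/WI.
  - by split; first exact: codeg_lt_msize.
exists (2^-1 *: I (I g)); first by rewrite linearZ /= !aI ag /I !raddf0.
have bI f : (I f)^`M(b) = f by apply: mprimK.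
have S'I f : dpsum (predC1 a) 1 (I f) = f + S (I f).
  by rewrite (dpsumD1_1 (i := b)) // bI.
have S'S f : dpsum (predC1 a) 1 (S f) = S (dpsum (predC1 a) 1 f).
  exact: dpsumC.
have T'I f : dpsum (predC1 a) 2 (I (I f)) = f + T (I (I f)).
  by rewrite (dpsumD1_2 (i := b)) // !bI.
rewrite /dquad !linearZ /= -scalerDr T'I S'I.
rewrite [dpsum _ 1 _]raddfD /= S'I S'S S'I.
rewrite -[RHS]Ng NE [S (_ + _)]raddfD /=.
set x := S (I g); set y := S (S _); set z := T _.
have -> : g + x + (x + y) + (g + z) = 2%:R *: (g + x) + (y + z).
  by rewrite scaler_nat; ring.
by rewrite scalerDr scalerA mulVf ?pnatr_eq0 // scale1r addrA.
Qed.

(** The unknown u is replaced by [u + N u] with [N = I_a S], which satisfies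
[d_a (u + N u) = dpsum predT 1 u]; it is sought as w + I_a g1 with w free
of x_a. *)
Lemma dpsum12_solve (a b : 'I_n) g1 g2 : b != a ->
    dpsum predT 2 g1 = dpsum predT 1 g2 ->
  exists2 u : {mpoly F[n]}, dpsum predT 1 u = g1 & dpsum predT 2 u = g2.
Proof.
move=> ba compat.
pose S := dpsum (predC1 a) 1; pose I := mprim a.
pose N : {additive {mpoly F[n]} -> {mpoly F[n]}} := I \o S.
have W0 f : codeg_lt a 0 f -> f = 0 by apply: codeg_lt0.
have WN d f : codeg_lt a d.+1 f -> codeg_lt a d (N f).
  by move=> Wf; apply/codeg_lt_mprim/codeg_lt_dpsum.
have D1 f : dpsum predT 1 f = f^`M(a) + S f by rewrite (dpsumD1_1 (i := a)).
have aU f : (f + N f)^`M(a) = dpsum predT 1 f by rewrite raddfD /= mprimK D1.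
have QD f g : dquad a (f + g) = dquad a f + dquad a g.
  by rewrite /dquad !raddfD /= addrACA.
have QU f : dquad a (f + N f) = dquad a f + N (dquad a f).
  rewrite QD; congr (_ + _); rewrite /N /= raddfD [RHS]raddfD /=.
  by rewrite /dquad /S /I [dpsum _ 1 (dpsum _ 2 f)]dpsumC !mprim_dpsum.
have aQ f : (dquad a f)^`M(a) = dquad a f^`M(a).
  by rewrite /dquad raddfD /= !mderiv_dpsum.
(* By [dpsum2_dquad], h is the value that dquad a must take at a solution u. *)
pose h := g2 - (g1^`M(a) - S g1).
have Dh : dpsum predT 1 h = dquad a g1.
  rewrite /h !raddfB /= -compat (dpsum2_dquad a) -mderiv_dpsum dpsumC -/S.
  by ring.
(* dquad a (w + I g1) = h + N h amounts to dquad a w = c. *)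
pose c := h + N h - dquad a (I g1).
have [|w aw Qw] := @dquad_surj a b c ba.
  by rewrite raddfB /= aU Dh aQ mprimK subrr.
have [u _ Uu] := unipotent_surj (W := codeg_lt a) W0 (@codeg_lt_zero a)
  (@codeg_ltB a) (@codeg_ltS a) WN (@codeg_lt_msize a (w + I g1)).
have Du : dpsum predT 1 u = g1 by rewrite -aU Uu raddfD /= aw mprimK add0r.
(* dquad a u and h are compared after applying 1 + N, which is injective. *)
have Qu : dquad a u = h.
  apply/subr0_eq/(unipotent_inj (W := codeg_lt a) W0 WN (@codeg_lt_msize a _)).
  by rewrite [N _]raddfB addrACA -QU Uu QD Qw subrK -opprD subrr.
by exists u => //; rewrite (dpsum2_dquad a) Du Qu /h -/S; ring.
Qed.

(** * Commutation with the operators x_i d_i^k *)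

(** The commutator of multiplication by x_i and the (l+1)-st derivative in x_i is
l+1 times the l-th derivative; applied to a k-th derivative, it gives order
k + l. *)
Lemma dpsum_mulX_sum k l f :
  dpsum predT l.+1 (\sum_(i < n) 'X_i * f^`M(i, k))
    = \sum_(i < n) 'X_i * (dpsum predT l.+1 f)^`M(i, k)
      + dpsum predT (k + l) f *+ l.+1.
Proof.
rewrite raddf_sum -sumrMnl -big_split /=; apply: eq_bigr => i _.
rewrite dpsum_mulX; congr ('X_i * _ + _ *+ _); last first.
  by rewrite !mderivn_iter -iterD addnC.
by rewrite /dpsum raddf_sum; apply: eq_bigr => j _; rewrite /= -!mderivmDm addmC.
Qed.

End PartialPowerSums.

Theorem mainTheorem4 (R : realType) (n : nat) (f0 : {mpoly R[i][n]})
    (hf0 : harmonic f0) :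
  exists f1 : {mpoly R[i][n]},
    nabla 1 f1 = - Dtilde 1 f0 /\ nabla 2 f1 = - Dtilde 2 f0.
Proof.
have df0 k : (0 < k)%N -> dpsum predT k f0 = 0 by move/hf0.
have killD k l : nabla l.+1 (Dtilde k f0) = 0.
  rewrite [LHS]dpsum_mulX_sum !df0 // mul0rn addr0.
  by apply: big1 => i _; rewrite raddf0 mulr0.
(* A single variable leaves no room for x_b, but there f0 is constant. *)
case: n => [|[|n]] in f0 hf0 df0 killD *.
- by exists 0; rewrite /nabla /Dtilde !big_ord0 oppr0.
- have f0' : f0^`M(ord0) = 0 by rewrite -nderivn1 -(hf0 1%N) // /nabla big_ord1.
  exists 0; rewrite /nabla /Dtilde !big_ord1 !mderivSn !raddf0.
  by rewrite f0' !raddf0 !mulr0 oppr0.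
have [||f1 H1 H2] := @dpsum12_solve _ _ ord0 ord_max (- Dtilde 1 f0) (- Dtilde 2 f0).
- by [].
- by rewrite !raddfN /= [dpsum _ 2 _]killD // [dpsum _ 1 _]killD.
by exists f1.
Qed.
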